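(* Let $R_1$ and $R_2$ be two discrete valuation rings, and let $A_1$ and $A_2$ be reduced countably generated torsion modules over $R_1$ and $R_2$ respectively such that, for each ordinal $\alpha$, the Ulm invariant $f_\alpha(A_1)$ is positive if and only if the Ulm invariant $f_\alpha(A_2)$ is positive. Then the posets of automorphism orbits of elements in $A_1$ and $A_2$ are canonically isomorphic, the isomorphism matching the orbit of $a_1\in A_1$ with the orbit of $a_2\in A_2$ when $a_1$ and $a_2$ have the same Ulm sequence.
   Context: A module is reduced if it has no nonzero divisible submodule. For a reduced torsion module $A$ over a discrete valuation ring $R$ with maximal ideal generated by $p$, define submodules $A_\alpha$ for ordinals $\alpha$ by $A_0=A$, $A_{\beta+1}=pA_\beta$, and $A_\alpha=\bigcap_{\beta<\alpha}A_\beta$ for limit ordinals $\alpha$ (here $A_\alpha$ with $\alpha$ an ordinal is not to be confused with the modules named $A_1,A_2$ in the claim). Ulm invariants: let $P(A)=\{a\in A\mid pa=0\}$ and $P(A)_\alpha=P(A)\cap A_\alpha$; the $\alpha$th Ulm invariant $f_\alpha(A)$ is the dimension of $P(A)_\alpha/P(A)_{\alpha+1}$ over the residue field $R/pR$. Height: a nonzero $a\in A$ has height $h(a)=\alpha$ if $a\in A_\alpha$ and $a\notin A_{\alpha+1}$; and $h(0)=\infty$, a symbol greater than every ordinal. The Ulm sequence of $a\in A$ is $\{h(p^ia)\}_{i\geq 0}$. The poset of automorphism orbits of elements in $A$: its elements are the orbits in $A$ of the group of $R$-module automorphisms of $A$, ordered by degeneration, with the orbit of $b$ being $\leq$ the orbit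 of $a$ if and only if $a$ degenerates to $b$, i.e. there is an $R$-module endomorphism $\phi$ of $A$ with $\phi(a)=b$ (this is a well-defined partial order). *)

(* Defs.v *)
From HB Require Import structures.
From mathcomp Require Import all_boot all_order all_algebra.
From mathcomp Require Import boolp classical_sets.

Set Implicit Arguments.
Unset Strict Implicit.
Unset Printing Implicit Defensive.

Import GRing.Theory.
Local Open Scope classical_set_scope.
Local Open Scope ring_scope.

(** * Ordinals

    The tree [OTree f] names the least ordinal greater than every ordinal named
    by [f i], [i : I].  By well-founded induction every well-ordered type in
    the universe of [I] has its order type named by some tree.  Ordinals are
    trees modulo naming the same ordinal, so that equality of ordinals is
    Leibniz equality.

    [otree] is indexed by types at least as large as the carriers of modules,
    so [ord] lives strictly above the universe of [eqType]: it cannot be given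
    an [eqType] structure or serve as the index type of [\bigcap]. *)

Inductive otree : Type := OTree (I : Type) (f : I -> otree).

Fixpoint tle (s t : otree) {struct s} : Prop :=
  match s, t with
  | @OTree X f, @OTree Y g => forall i : X, exists j : Y, tle (f i) (g j)
  end.

Definition tlt (s t : otree) : Prop :=
  match t with @OTree Y g => exists j : Y, tle s (g j) end.

Definition tclass (s : otree) : otree -> Prop := fun t => tle s t /\ tle t s.

Definition ord : Type := {C : otree -> Prop | exists t, C = tclass t}.

Definition ord_of (t : otree) : ord :=
  exist _ (tclass t) (ex_intro _ t (erefl (tclass t))).

Definition ord_lt (a b : ord) : Prop :=
  exists s t, [/\ a = ord_of s, b = ord_of t & tlt s t].

Definition trepr (a : ord) : otree := sval (cid (svalP a)).

Definition ord_zero : ord := ord_of (OTree (fun e : False => match e with end)).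

Definition ord_succ (a : ord) : ord := ord_of (OTree (fun _ : unit => trepr a)).

Definition ord_limit (a : ord) : Prop :=
  a <> ord_zero /\ forall b, a <> ord_succ b.

(** The least ordinal greater than every [F i]. *)
Definition ord_sup_succ (I : Type) (F : I -> ord) : ord :=
  ord_of (OTree (fun i => trepr (F i))).

Lemma tle_refl t : tle t t.
Proof. by elim: t => I f IH /= i; exists i. Qed.

Lemma tle_trans s t u : tle s t -> tle t u -> tle s u.
Proof.
elim: s t u => I f IH [J g] [K h] /= st tu i.
have [j ij] := st i; have [k jk] := tu j.
by exists k; apply: IH ij jk.
Qed.

Lemma tle_lt_trans s t u : tle s t -> tlt t u -> tlt s u.
Proof. by case: u => K h /= st [k tk]; exists k; apply: tle_trans st tk. Qed.

Lemma tlt_le_trans s t u : tlt s t -> tle t u -> tlt s u.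
Proof.
case: t u => [J g] [K h] /= [j sj] tu; have [k jk] := tu j.
by exists k; apply: tle_trans sj jk.
Qed.

Lemma tltW s t : tlt s t -> tle s t.
Proof.
elim: s t => I f IH [J g] /= [j sj] i; exists j.
by apply: IH; apply: (@tlt_le_trans _ (OTree f)) sj; exists i; apply: tle_refl.
Qed.

Lemma tle_or_lt s t : tle s t \/ tlt t s.
Proof.
elim: s t => I f IH [J g] /=.
have [[i Hi]|H] := pselect (exists i, tle (OTree g) (f i)).
  by right; exists i.
left=> i; have [j|nj] := pselect (exists j, tle (f i) (g j)) => //.
exfalso; apply: H; exists i.
case: (f i) (IH i) nj => K h IHi nj /= j.
by case: (IHi (g j)) => // ij; case: nj; exists j.
Qed.

Lemma tlt_wf : well_founded tlt.
Proof.
suff H t : forall s, tle s t -> Acc tlt s by move=> t; apply: (H t); apply: tle_refl.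
elim: t => I f IH s st; constructor=> u us.
have [i ui] := tlt_le_trans us st.
exact: IH ui.
Qed.

Lemma tlt_irr t : ~ tlt t t.
Proof. by elim/(well_founded_ind tlt_wf): t => t IH tt; apply: (IH t). Qed.

Lemma ord_of_eq s t : ord_of s = ord_of t <-> tle s t /\ tle t s.
Proof.
split=> [[E]|[st ts]].
  have : tclass t t by split; apply: tle_refl.
  by rewrite -E.
apply: eq_exist; apply/funext => u; apply/propext; split=> -[h k]; split.
- exact: tle_trans ts h.
- exact: tle_trans k st.
- exact: tle_trans st h.
- exact: tle_trans k ts.
Qed.

Lemma treprK a : ord_of (trepr a) = a.
Proof.
by case: a => C HC; apply: eq_exist; rewrite /trepr; case: (cid _) => /= t ->.
Qed.

Lemma ord_ltE s t : ord_lt (ord_of s) (ord_of t) <-> tlt s t.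
Proof.
split=> [[s' [t' [/ord_of_eq[ss' _] /ord_of_eq[_ tt'] st]]]|st]; last by exists s, t.
exact: tle_lt_trans ss' (tlt_le_trans st tt').
Qed.

Lemma ord_lt_wf : well_founded ord_lt.
Proof.
move=> a; rewrite -(treprK a).
elim/(well_founded_ind tlt_wf): (trepr a) => t IH.
by constructor=> b; rewrite -(treprK b) => /ord_ltE/IH.
Qed.

Lemma ord_lt_irr a : ~ ord_lt a a.
Proof. by rewrite -(treprK a) => /ord_ltE/tlt_irr. Qed.

Lemma ord_lt_trans a b c : ord_lt a b -> ord_lt b c -> ord_lt a c.
Proof.
rewrite -(treprK a) -(treprK b) -(treprK c) => /ord_ltE ab /ord_ltE bc.
by apply/ord_ltE; apply: tlt_le_trans ab (tltW bc).
Qed.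

Lemma ord_lt_total a b : [\/ ord_lt a b, a = b | ord_lt b a].
Proof.
rewrite -(treprK a) -(treprK b).
case: (tle_or_lt (trepr a) (trepr b)) => [ab|ba]; last by apply: Or33; apply/ord_ltE.
case: (tle_or_lt (trepr b) (trepr a)) => [ba|ab']; last by apply: Or31; apply/ord_ltE.
by apply: Or32; apply/ord_of_eq.
Qed.

Lemma ord_lt0 a : ~ ord_lt a ord_zero.
Proof. by rewrite -(treprK a) => /ord_ltE[]. Qed.

Lemma ord_lt_succ a b : ord_lt a (ord_succ b) <-> ord_lt a b \/ a = b.
Proof.
rewrite -(treprK a) -(treprK b); set s := trepr a; set t := trepr b.
have tt' : tle t (trepr (ord_of t)) /\ tle (trepr (ord_of t)) t.
  by apply/ord_of_eq; rewrite treprK.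
split=> [/ord_ltE[_ st]|].
  have {}st : tle s t by apply: tle_trans st tt'.2.
  case: (tle_or_lt t s) => ts; last by left; apply/ord_ltE.
  by right; apply/ord_of_eq.
move=> H; apply/ord_ltE; exists tt; apply: tle_trans tt'.1.
by case: H => [/ord_ltE/tltW//|/ord_of_eq[]].
Qed.

Lemma ord_lt_sup_succ (I : Type) (F : I -> ord) i : ord_lt (F i) (ord_sup_succ F).
Proof.
by rewrite -{1}(treprK (F i)); apply/ord_ltE; exists i; apply: tle_refl.
Qed.

Lemma ord_sup_succ_least (I : Type) (F : I -> ord) b :
  (forall i, ord_lt (F i) b) -> ~ ord_lt b (ord_sup_succ F).
Proof.
move=> H; rewrite -(treprK b) => /ord_ltE[i bi].
have := H i; rewrite -(treprK b) -(treprK (F i)) => /ord_ltE/(tle_lt_trans bi).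
exact: tlt_irr.
Qed.

Lemma ord_succ_inj a b : ord_succ a = ord_succ b -> a = b.
Proof.
move=> E.
have : ord_lt a (ord_succ b) by rewrite -E; apply/ord_lt_succ; right.
have : ord_lt b (ord_succ a) by rewrite E; apply/ord_lt_succ; right.
case/ord_lt_succ => [ba|->//] /ord_lt_succ[ab|->//].
by case: (@ord_lt_irr a); apply: ord_lt_trans ab ba.
Qed.

Lemma ord_zero_succ a : ord_zero <> ord_succ a.
Proof. by move=> E; apply: (@ord_lt0 a); rewrite E; apply/ord_lt_succ; right. Qed.

(** * Submodules and discrete valuation rings *)

Definition submodule (R : nzRingType) (V : lmodType R) (D : set V) : Prop :=
  GRing.submod_closed [in D].

Definition ideal (R : idomainType) (I : set R) : Prop :=
  submodule (I : set R^o).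

Definition principal_ideal (R : idomainType) (g : R) : set R :=
  [set r * g | r in setT].

Definition maximal_ideal (R : idomainType) (M : set R) : Prop :=
  [/\ ideal M, M <> setT &
      forall I, ideal I -> M `<=` I -> I = M \/ I = setT].

(** A principal ideal domain with a unique maximal ideal, not a field. *)
Definition is_dvr (R : idomainType) : Prop :=
  (forall I : set R, ideal I -> exists g, I = principal_ideal g) /\
  exists M : set R,
    [/\ maximal_ideal M, forall N, maximal_ideal N -> N = M & M <> [set 0]].

(** * Modules *)

Definition torsion (R : idomainType) (A : lmodType R) : Prop :=
  forall a : A, exists2 r : R, r != 0 & r *: a = 0.

(** The generators need not be distinct, so finitely generated modules are
    included. *)
Definition countably_generated (R : idomainType) (A : lmodType R) : Prop :=
  exists g : nat -> A, forall a, exists n (r : 'I_n -> R),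
    a = \sum_(i < n) r i *: g i.

Definition divisible (R : idomainType) (A : lmodType R) (D : set A) : Prop :=
  forall r : R, r != 0 -> D `<=` [set r *: d | d in D].

Definition reduced (R : idomainType) (A : lmodType R) : Prop :=
  forall D : set A, submodule D -> divisible D -> D = [set 0].

Section Ulm.
Variables (R : idomainType) (p : R) (A : lmodType R).

Definition ulm_step (a : ord) (rec : forall b, ord_lt b a -> set A) : set A :=
  [set x | (forall b (ba : ord_lt b a), a = ord_succ b ->
              [set p *: y | y in rec b ba] x) /\
           (ord_limit a -> forall b (ba : ord_lt b a), rec b ba x)].

(** The submodule [A_a] of the Ulm filtration, characterized by the equations
    [ulm_filtration0], [ulm_filtrationS] and [ulm_filtration_limit]. *)
Definition ulm_filtration : ord -> set A :=
  Fix ord_lt_wf (fun _ => set A) ulm_step.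

Lemma ulm_filtrationE a :
  ulm_filtration a = ulm_step (fun b (_ : ord_lt b a) => ulm_filtration b).
Proof.
rewrite {1}/ulm_filtration Fix_eq // => {}a f g fg.
by congr ulm_step; apply/functional_extensionality_dep => b; apply/funext => ba.
Qed.

Lemma ulm_filtration0 : ulm_filtration ord_zero = setT.
Proof.
rewrite ulm_filtrationE; apply/seteqP; split=> // x _.
by split=> [b /ord_lt0|[]//].
Qed.

Lemma ulm_filtrationS b :
  ulm_filtration (ord_succ b) = [set p *: y | y in ulm_filtration b].
Proof.
have bS : ord_lt b (ord_succ b) by apply/ord_lt_succ; right.
rewrite ulm_filtrationE; apply/seteqP; split=> [x [H _]|x H]; first exact: H.
by split=> [c _ /ord_succ_inj <-|[_ /(_ b)]].
Qed.

Lemma ulm_filtration_limit a : ord_limit a ->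
  forall x, ulm_filtration a x <-> forall b, ord_lt b a -> ulm_filtration b x.
Proof.
move=> la x; rewrite ulm_filtrationE; split=> [[_ /(_ la)]//|H].
by split=> [b _ /la.2|_ b ba] //; apply: H.
Qed.

Lemma ulm_filtration_submodule a : submodule (ulm_filtration a).
Proof.
elim/(well_founded_ind ord_lt_wf): a => a IH.
have sub0 b (D := ulm_filtration b) : submodule D -> D 0 by case=> /set_mem.
have subL b (D := ulm_filtration b) : submodule D ->
    forall r x y, D x -> D y -> D (r *: x + y).
  by case=> _ H r x y /mem_set Dx /mem_set Dy; apply/set_mem/H.
split=> [|r x y /set_mem + /set_mem +]; [|move=> xa ya]; apply/mem_set.
  rewrite ulm_filtrationE; split=> [b ba _|_ b ba]; last exact/sub0/IH.
  by exists 0; rewrite ?scaler0//; apply/sub0/IH.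
move: xa ya; rewrite ulm_filtrationE => -[xS xL] [yS yL].
split=> [b ba ab|la b ba].
  have [[x' bx <-] [y' by' <-]] := (xS b ba ab, yS b ba ab).
  exists (r *: x' + y'); first by apply: subL => //; apply: IH.
  by rewrite scalerDr !scalerA mulrC.
by apply: subL; [apply: IH|apply: xL|apply: yL].
Qed.

Lemma ulm_filtration_anti a b :
  ord_lt a b -> ulm_filtration b `<=` ulm_filtration a.
Proof.
elim/(well_founded_ind ord_lt_wf): b a => b IH a ab.
have [lb|nlb] := pselect (ord_limit b).
  by move=> x /(ulm_filtration_limit lb); apply.
have [c bc] : exists c, b = ord_succ c.
  apply: contrapT => nc; apply: nlb; split=> [b0|c bc]; last by apply: nc; exists c.
  by apply: (@ord_lt0 a); rewrite -b0.
have bcs : ulm_filtration b `<=` ulm_filtration c.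
  rewrite bc => x; rewrite ulm_filtrationS => -[y cy <-].
  have [s0 sL] := ulm_filtration_submodule c.
  by have /set_mem := sL p y 0 (mem_set cy) s0; rewrite addr0.
have cb : ord_lt c b by rewrite bc; apply/ord_lt_succ; right.
move: ab; rewrite {1}bc => /ord_lt_succ[ac|->//].
exact: subset_trans bcs (IH c cb a ac).
Qed.

(** The intersection of the filtration is [p]-divisible.  The proof takes a
    supremum of ordinals indexed by the carrier of [A], so it also records that
    [ord] is closed under suprema of families of that size. *)
Lemma ulm_filtration_core_divisible x :
  (forall a, ulm_filtration a x) ->
  exists2 y, (forall a, ulm_filtration a y) & p *: y = x.
Proof.
move=> H; apply: contrapT => N.
have [F HF] : exists F : A -> ord,
    forall y, p *: y = x -> ~ ulm_filtration (F y) y.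
  suff G y : exists a, p *: y = x -> ~ ulm_filtration a y.
    by exists (fun y => sval (cid (G y))) => y; case: (cid (G y)).
  apply: contrapT => M; apply: N.
  exists y; last by apply: contrapT => E; apply: M; exists ord_zero => /E.
  by move=> a; apply: contrapT => E; apply: M; exists a.
have := H (ord_succ (ord_sup_succ F)); rewrite ulm_filtrationS => -[y yb E].
by apply: (HF y E); apply: ulm_filtration_anti yb; apply: ord_lt_sup_succ.
Qed.

Lemma ulm_filtration_core x :
  (forall a, ulm_filtration a x -> ulm_filtration (ord_succ a) x) ->
  forall a, ulm_filtration a x.
Proof.
move=> H a; elim/(well_founded_ind ord_lt_wf): a => a IH.
have [l|nl] := pselect (ord_limit a).
  by apply/(ulm_filtration_limit l) => b; apply: IH.
have [->|a0] := pselect (a = ord_zero); first by rewrite ulm_filtration0.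
have [b E] : exists b, a = ord_succ b.
  by apply: contrapT => N; apply: nl; split=> // b E; apply: N; exists b.
by rewrite E; apply: H; apply: IH; rewrite E; apply/ord_lt_succ; right.
Qed.

Definition socle : set A := [set x | p *: x = 0].

Definition socle_filtration (a : ord) : set A := socle `&` ulm_filtration a.

(** [ulm_invariant a K] states that the [a]-th Ulm invariant is the cardinal
    [|K|]: the family [e : K -> A] represents a basis indexed by [K] of
    [socle_filtration a / socle_filtration (a + 1)] over the residue field
    [R / pR].  A coefficient [r : R] stands for its residue, which vanishes
    iff [r] is a multiple of [p]. *)
Definition ulm_invariant (a : ord) (K : Type) : Prop :=
  exists e : K -> A,
  [/\ forall k, socle_filtration a (e k),
      forall n (k : 'I_n -> K) (r : 'I_n -> R), injective k ->
        socle_filtration (ord_succ a) (\sum_(i < n) r i *: e (k i)) ->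
        forall i, principal_ideal p (r i) &
      forall x, socle_filtration a x -> exists n (k : 'I_n -> K) (r : 'I_n -> R),
        socle_filtration (ord_succ a) (x - \sum_(i < n) r i *: e (k i))].

Definition ulm_invariant_positive (a : ord) : Prop :=
  exists K : Type, inhabited K /\ ulm_invariant a K.

(** [None] is the height [oo] of [0].  The last branch is not reached when [A]
    is a reduced torsion module over a discrete valuation ring whose maximal
    ideal is generated by [p]. *)
Definition height (x : A) : option ord :=
  if x == 0 then None else
  match pselect (exists a, ulm_filtration a x /\ ~ ulm_filtration (ord_succ a) x) with
  | left h => Some (sval (cid h))
  | right _ => None
  end.

Definition ulm_sequence (x : A) : nat -> option ord :=
  fun i => height (p ^+ i *: x).

Lemma height_eq x a :
  ulm_filtration a x -> ~ ulm_filtration (ord_succ a) x -> height x = Some a.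
Proof.
move=> ax nax; rewrite /height; case: eqP => [x0|_].
  by case: nax; rewrite x0; case: (ulm_filtration_submodule (ord_succ a)) => /set_mem.
case: pselect => [h|[]]; last by exists a.
case: (cid h) => /= b [bx nbx]; congr Some.
have key c d : ord_lt c d -> ulm_filtration d x -> ulm_filtration (ord_succ c) x.
  move=> cd; case: (ord_lt_total (ord_succ c) d) => [|->//|].
    by move=> /ulm_filtration_anti; apply.
  move=> /ord_lt_succ[dc|dc]; case: (@ord_lt_irr c).
    exact: ord_lt_trans cd dc.
  by rewrite -{2}dc.
by case: (ord_lt_total b a) => [/key/(_ ax)|//|/key/(_ bx)].
Qed.

End Ulm.

(** * Automorphism orbits and degeneration *)

Section Orbits.
Variables (R : idomainType) (A : lmodType R).

Definition orbit (x : A) : set A :=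
  [set y | exists2 f : {linear A -> A}, bijective f & f x = y].

Definition orbits : Type := {O : set A | exists x, O = orbit x}.

Definition to_orbits (x : A) : orbits :=
  exist _ (orbit x) (ex_intro _ x (erefl (orbit x))).

Definition degenerates (x y : A) : Prop :=
  exists f : {linear A -> A}, f x = y.

Definition orbit_le (O O' : orbits) : Prop :=
  exists x y, [/\ O' = to_orbits x, O = to_orbits y & degenerates x y].

Lemma orbit_eq_degenerates x y : to_orbits x = to_orbits y -> degenerates x y.
Proof.
case=> /seteqP[_ /(_ y)]; case; last by move=> f _ fx; exists f.
by exists (idfun : {linear A -> A}) => //; exists idfun.
Qed.

Lemma degenerates_trans x y z :
  degenerates x y -> degenerates y z -> degenerates x z.
Proof. by move=> [f fx] [g gy]; exists (g \o f : {linear A -> A}); rewrite /= fx. Qed.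

Lemma orbit_leE x y : orbit_le (to_orbits y) (to_orbits x) <-> degenerates x y.
Proof.
split=> [[x' [y' [/orbit_eq_degenerates xx' yy' x'y']]]|]; last by exists x, y.
by apply: degenerates_trans xx' (degenerates_trans x'y' (orbit_eq_degenerates (esym yy'))).
Qed.

End Orbits.

(* Main.v *)
Require Import Defs.
From HB Require Import structures.
From mathcomp Require Import all_boot all_order all_algebra.
From mathcomp Require Import boolp classical_sets.

Set Implicit Arguments.
Unset Strict Implicit.
Unset Printing Implicit Defensive.

Import GRing.Theory.
Local Open Scope classical_set_scope.
Local Open Scope ring_scope.

(** Write [F a] for the submodules of the Ulm filtration, [A_a] in the usual
    notation.  For [A] reduced, [x] has height [a] iff [F a x] and not
    [F (a + 1) x], and two elements have the same height iff they lie in the same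
    [F a].  The theorem follows from two facts.

    Realization ([same_heights_ex]).  The Ulm sequences of [A] are the strictly
    increasing finite sequences of ordinals, prolonged by infinity, such that the
    [a]-th Ulm invariant is positive whenever [a] is followed by something
    greater than [a + 1] ([height_gap]).  Hence [A1] and [A2] have the same Ulm
    sequences.  Given [x] in [A1], induction on the order of [x] gives [z] in
    [A2] realizing the Ulm sequence of [p1 x]; an element [y] with [p2 y = z] and
    the height of [x] is then found by division, corrected by a socle element
    where there is a gap.

    Transitivity (after Kaplansky and Mackey).  [x] degenerates to [y] iff the
    Ulm sequence of [x] is termwise at most that of [y] ([degeneratesP]), and [x]
    and [y] are in the same orbit iff their Ulm sequences are equal
    ([to_orbitsP]).  One extends the map [R x -> R y] to larger and larger
    submodules, meeting all members of a countable generating family.  To extend a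
    map from [S] to [S + R x], where [p x] is in [S], choose [x] of maximal
    height in its coset modulo [S]; such an element exists since [S] satisfies
    the descending chain condition ([coset_max_height]).  For endomorphisms it is
    enough that heights do not decrease, and [x] may be sent to any element of
    height at least [h(x)] whose multiple by [p] is the image of [p x]
    ([partial_hom_forth]).  For automorphisms heights are preserved, so the image
    of [x] must have the height of [x], maximal in its coset as well
    ([partial_iso_forth]).  This is automatic when [p x] has height [h(x) + 1],
    once [x] is chosen to maximize [h(p x)] too; when [p x] has height greater
    than [h(x) + 1] a new socle element is needed in the target.  It is provided
    by [partial_iso_exchange]. *)

(** * Submodules *)

Section Submodules.
Variables (R : nzRingType) (V : lmodType R).
Implicit Types (D S : set V) (x y v : V).

Lemma submoduleP D :
  submodule D <-> D 0 /\ forall r x y, D x -> D y -> D (r *: x + y).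
Proof.
split=> [[/set_mem D0 DL]|[D0 DL]]; split=> //.
- by move=> r x y /mem_set Dx /mem_set Dy; apply/set_mem/DL.
- exact/mem_set.
- by move=> r x y /set_mem Dx /set_mem Dy; apply/mem_set/DL.
Qed.

Lemma submodule0 D : submodule D -> D 0.
Proof. by case/submoduleP. Qed.

Lemma submoduleD D x y : submodule D -> D x -> D y -> D (x + y).
Proof. by case/submoduleP=> _ + Dx Dy => /(_ 1 x y Dx Dy); rewrite scale1r. Qed.

Lemma submoduleZ D r x : submodule D -> D x -> D (r *: x).
Proof. by case/submoduleP=> D0 + Dx => /(_ r x 0 Dx D0); rewrite addr0. Qed.

Lemma submoduleN D x : submodule D -> D x -> D (- x).
Proof. by move=> sD Dx; rewrite -scaleN1r; apply: submoduleZ. Qed.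

Lemma submoduleB D x y : submodule D -> D x -> D y -> D (x - y).
Proof. by move=> sD Dx Dy; apply: submoduleD => //; apply: submoduleN. Qed.

Lemma submodule_sum D n (r : 'I_n -> R) (e : 'I_n -> V) :
  submodule D -> (forall i, D (e i)) -> D (\sum_(i < n) r i *: e i).
Proof.
move=> sD De; elim/big_rec: _ => [|i x _ Dx]; first exact: submodule0.
by apply: submoduleD => //; apply: submoduleZ.
Qed.

Lemma submoduleI D S : submodule D -> submodule S -> submodule (D `&` S).
Proof.
move=> /submoduleP[D0 DL] /submoduleP[S0 SL]; apply/submoduleP; split=> //.
by move=> r x y [Dx Sx] [Dy Sy]; split; [apply: DL|apply: SL].
Qed.

Lemma submodule_zero : submodule [set (0 : V)].
Proof. by apply/submoduleP; split=> // r _ _ -> ->; rewrite scaler0 addr0. Qed.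

(** The submodule [D + R v]. *)
Definition adjoin D v : set V := [set x | exists d r, D d /\ x = d + r *: v].

Lemma adjoin_submodule D v : submodule D -> submodule (adjoin D v).
Proof.
move=> sD; apply/submoduleP; split.
  by exists 0, 0; rewrite scale0r addr0; split=> //; apply: submodule0.
move=> r x y [d [a [Dd ->]]] [e [b [De ->]]].
exists (r *: d + e), (r * a + b); split.
  by apply: submoduleD => //; apply: submoduleZ.
by rewrite scalerDr scalerDl scalerA addrACA.
Qed.

Lemma sub_adjoin D v : D `<=` adjoin D v.
Proof. by move=> x Dx; exists x, 0; rewrite scale0r addr0. Qed.

Lemma adjoin_mem D v : submodule D -> adjoin D v v.
Proof. by move=> sD; exists 0, 1; rewrite scale1r add0r; split=> //; apply: submodule0. Qed.

Lemma adjoin_min D S v : submodule S -> D `<=` S -> S v -> adjoin D v `<=` S.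
Proof.
move=> sS DS Sv _ [d [r [Dd ->]]].
by apply: submoduleD => //; [apply: DS|apply: submoduleZ].
Qed.

(** The descending chain condition, in the form of the stabilization of
    decreasing sequences, on the submodules contained in [S]. *)
Definition dcc S : Prop := forall D : nat -> set V,
  (forall n, submodule (D n)) -> (forall n, D n `<=` S) ->
  (forall n, D n.+1 `<=` D n) -> exists N, forall n, (N <= n)%N -> D N `<=` D n.

Lemma dcc_sub S S' : S' `<=` S -> dcc S -> dcc S'.
Proof. by move=> S'S dS D sD DS; apply: dS => // n; apply: subset_trans (DS n) S'S. Qed.

Lemma decr_chain (D : nat -> set V) : (forall n, D n.+1 `<=` D n) ->
  forall m n, (m <= n)%N -> D n `<=` D m.
Proof.
move=> dD m; elim=> [|n IH]; first by rewrite leqn0 => /eqP->.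
rewrite leq_eqVlt => /orP[/eqP->//|]; rewrite ltnS => /IH.
exact: subset_trans (dD n).
Qed.

Lemma dcc0 : dcc [set 0].
Proof.
move=> D sD DS _; exists 0%N => n _ x /DS ->; exact: submodule0.
Qed.

End Submodules.

(** * Discrete valuation rings *)

Section Uniformizer.
Variable R : idomainType.
Implicit Types r p : R.

(** [p] is a nonunit and every nonzero element is a unit times a power of [p]. *)
Definition uniformizer p : Prop :=
  p \isn't a GRing.unit /\
  forall r, r != 0 -> exists n, exists2 u, u \is a GRing.unit & r = u * p ^+ n.

Lemma principal_idealP p r : principal_ideal p r <-> exists c, r = c * p.
Proof. by split=> [[c _ <-]|[c ->]]; exists c. Qed.

Lemma principal_ideal_ideal p : ideal (principal_ideal p).
Proof.
apply/submoduleP; split; first by exists 0 => //; rewrite mul0r.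
move=> a _ _ [c _ <-] [d _ <-]; exists (a * c + d) => //.
by rewrite mulrDl -mulrA.
Qed.

Lemma principal_idealS p r : principal_ideal p r ->
  principal_ideal r `<=` principal_ideal p.
Proof. by move=> [c _ <-] _ [d _ <-]; exists (d * c) => //; rewrite mulrA. Qed.

Lemma principal_ideal_unit p : principal_ideal p = setT <-> p \is a GRing.unit.
Proof.
split=> [pT|pU].
  have [c _ cp] : principal_ideal p 1 by rewrite pT.
  by apply/unitrPr; exists c; rewrite mulrC.
by apply/seteqP; split=> // x _; exists (x / p) => //; rewrite divrK.
Qed.

(** The ascending chain condition: no nonempty set of elements of a principal ideal
    domain contains a proper divisor of each of its members. *)
Lemma pid_acc (Q : R -> Prop) :
  (forall I : set R, ideal I -> exists g, I = principal_ideal g) ->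
  (forall r, Q r -> exists r',
    [/\ Q r', principal_ideal r' r & ~ principal_ideal r r']) ->
  forall r, ~ Q r.
Proof.
move=> pid step r Qr.
have step' (s : {r | Q r}) : {s' : {r | Q r} |
    principal_ideal (sval s') (sval s) /\ ~ principal_ideal (sval s) (sval s')}.
  by apply: cid; case: (step _ (svalP s)) => r' [Qr' ? ?]; exists (exist _ r' Qr').
have [f [_ fS]] := dependent_choice step' (exist _ r Qr).
pose J n := principal_ideal (sval (f n)).
have Jle n m : (n <= m)%N -> J n `<=` J m.
  elim: m => [|m IH]; first by rewrite leqn0 => /eqP->.
  rewrite leq_eqVlt => /orP[/eqP->//|/IH nm].
  by apply: subset_trans nm _; apply: principal_idealS; case: (fS m).
pose I := [set x | exists n, J n x].
have idI : ideal I.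
  apply/submoduleP; split.
    by exists 0%N; apply: (submodule0 (principal_ideal_ideal _)).
  move=> a x y [n nx] [m my]; exists (maxn n m).
  apply: (submoduleD (principal_ideal_ideal _)); last exact: Jle (leq_maxr _ _) _ my.
  by apply: (submoduleZ _ (principal_ideal_ideal _)); apply: Jle (leq_maxl _ _) _ nx.
have [g Ig] := pid I idI.
have [n ng] : I g by rewrite Ig; exists 1 => //; rewrite mul1r.
case: (fS n) => _; apply; apply: principal_idealS ng _ _; rewrite -Ig.
by exists n.+1, 1 => //; rewrite mul1r.
Qed.

Lemma dvr_uniformizer p :
  is_dvr R -> maximal_ideal (principal_ideal p) -> uniformizer p.
Proof.
move=> [pid [M [Mmax Muniq _]]] pmax.
have pU : p \isn't a GRing.unit.
  by apply/negP => /principal_ideal_unit; case: pmax.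
have nonunit r : r \isn't a GRing.unit -> principal_ideal p r.
  move=> rU; apply: contrapT => rp.
  apply: (@pid_acc (fun s => s \isn't a GRing.unit /\ ~ principal_ideal p s))
    (conj rU rp) => // {rU rp}s [sU sp].
  have nmax : ~ maximal_ideal (principal_ideal s).
    move=> smax; apply: sp; rewrite (Muniq _ pmax) -(Muniq _ smax).
    by exists 1 => //; rewrite mul1r.
  have sT : principal_ideal s <> setT by move=> /principal_ideal_unit; apply/negP.
  have [J [idJ sJ Js JT]] : exists J : set R,
      [/\ ideal J, principal_ideal s `<=` J, J <> principal_ideal s & J <> setT].
    apply: contrapT => N; apply: nmax; split=> //; first exact: principal_ideal_ideal.
    move=> J idJ sJ; apply: contrapT => /not_orP[? ?]; apply: N.
    by exists J; split.
  have [g Jg] := pid J idJ; rewrite {}Jg in sJ Js JT.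
  have gs : principal_ideal g s by apply: sJ; exists 1 => //; rewrite mul1r.
  exists g; split=> //.
    split; first by apply/negP => /principal_ideal_unit.
    by move=> pg; apply: sp; apply: principal_idealS pg _ gs.
  by move=> sg; apply: Js; apply/seteqP; split=> //; apply: principal_idealS.
split=> // r r0; apply: contrapT => rN.
pose Q s := s != 0 /\
  ~ exists n, exists2 u, u \is a GRing.unit & s = u * p ^+ n.
apply: (@pid_acc Q) (conj r0 rN) => // {r0 rN}s [s0 sN].
have /nonunit/principal_idealP[c sE] : s \isn't a GRing.unit.
  by apply/negP => sU; apply: sN; exists 0%N, s; rewrite ?expr0 ?mulr1.
have c0 : c != 0 by apply: contra_neq s0; rewrite sE => ->; rewrite mul0r.
exists c; split.
- split=> // -[n [u uU cE]]; apply: sN; exists n.+1, u => //.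
  by rewrite sE cE exprSr mulrA.
- by exists p => //; rewrite mulrC.
- case=> d _; rewrite sE mulrCA -{2}(mulr1 c) => /(mulfI c0) dp.
  by move/negP: pU; apply; apply/unitrPr; exists d; rewrite mulrC.
Qed.

Variable p : R.
Hypothesis pP : uniformizer p.

Lemma uniformizer_unit r : ~ principal_ideal p r -> r \is a GRing.unit.
Proof.
move=> rp; have r0 : r != 0.
  by apply: contra_notN rp => /eqP->; exists 0 => //; rewrite mul0r.
have [[|n] [u uU rE]] := pP.2 r r0; first by rewrite rE expr0 mulr1.
by case: rp; exists (u * p ^+ n) => //; rewrite rE exprSr mulrA.
Qed.

Lemma uniformizer_not1 : ~ principal_ideal p 1.
Proof.
move=> [c _ cp]; case/negP: pP.1; apply/unitrPr; exists c; by rewrite mulrC.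
Qed.

Variable A : lmodType R.

Lemma torsion_power : torsion A -> forall a : A, exists n, p ^+ n *: a = 0.
Proof.
move=> tors a; have [r r0 ra] := tors a; have [n [u uU rE]] := pP.2 r r0.
by exists n; rewrite -[LHS]scale1r -(mulVr uU) -scalerA [u *: _]scalerA -rE ra scaler0.
Qed.

(** The quotient of [adjoin S v] by [S] is zero or simple. *)
Lemma dcc_adjoin (S : set A) v :
  submodule S -> S (p *: v) -> dcc S -> dcc (adjoin S v).
Proof.
move=> sS Spv dS D sD DS dD.
have [N HN] : exists N, forall n, (N <= n)%N -> D N `&` S `<=` D n `&` S.
  apply: (dS (fun n => D n `&` S)) => [n|n x []//|n x [/dD]//].
  exact: submoduleI.
have [[M MS]|nS] := pselect (exists M, D M `<=` S).
  exists (maxn M N) => n; rewrite geq_max => /andP[_ Nn] x xD.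
  suff /(HN n Nn)[] : (D N `&` S) x by [].
  split; first exact: decr_chain dD _ _ (leq_maxr _ _) _ xD.
  exact: MS (decr_chain dD (leq_maxl _ _) xD).
exists N => n Nn x xD.
have [y [yD yS]] : exists y, D n y /\ ~ S y.
  apply: contrapT => H; apply: nS; exists n => y yD.
  by apply: contrapT => yS; apply: H; exists y.
have [d [a [Sd xE]]] := DS _ _ xD; have [e [b [Se yE]]] := DS _ _ yD.
have bU : b \is a GRing.unit.
  apply: uniformizer_unit => /principal_idealP[c bE]; apply: yS; rewrite yE.
  by apply: submoduleD => //; rewrite bE -scalerA; apply: submoduleZ.
pose z := x - (a / b) *: y.
have zD : D N z.
  apply: submoduleB => //; apply: submoduleZ => //.
  exact: decr_chain dD _ _ Nn _ yD.
have zS : S z.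
  rewrite /z xE yE scalerDr scalerA divrK // opprD addrACA subrr addr0.
  by apply: submoduleB => //; apply: submoduleZ.
have [zn _] := HN n Nn z (conj zD zS).
rewrite -(subrK ((a / b) *: y) x); apply: submoduleD => //.
exact: submoduleZ.
Qed.

Lemma dcc_adjoin_power n (S : set A) v :
  submodule S -> S (p ^+ n *: v) -> dcc S -> dcc (adjoin S v).
Proof.
elim: n S v => [|n IH] S v sS.
  rewrite expr0 scale1r => Sv; apply: dcc_sub; exact: adjoin_min.
rewrite exprSr -scalerA => Spv dS.
have sS' := adjoin_submodule (p *: v) sS.
apply: (dcc_sub _ (dcc_adjoin sS' (adjoin_mem _ sS) (IH _ _ sS Spv dS))).
move=> _ [d [r [Sd ->]]]; exists d, r; split=> //; exact: sub_adjoin.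
Qed.

End Uniformizer.

(** * The Ulm filtration *)

Section Filtration.
Variables (R : idomainType) (p : R) (A : lmodType R).
Local Notation F := (@ulm_filtration _ p A).
Let sF := @ulm_filtration_submodule R p A.
Implicit Types (a b : ord) (x y : A).

Lemma filtration_total a b : F a `<=` F b \/ F b `<=` F a.
Proof.
case: (ord_lt_total a b) => [ab|->|ba]; [right|by left|left];
  exact: ulm_filtration_anti.
Qed.

Lemma filtrationSS a : F (ord_succ a) `<=` F a.
Proof. by apply: ulm_filtration_anti; apply/ord_lt_succ; right. Qed.

Lemma filtration_mem0 a : F a 0.
Proof. exact: submodule0. Qed.

Lemma filtration_scale a x : F a x -> F (ord_succ a) (p *: x).
Proof. by move=> ax; rewrite ulm_filtrationS; exists x. Qed.

(** An element of height [a] lies exactly in the [F b] with [b <= a]. *)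
Lemma filtration_height a x : F a x -> ~ F (ord_succ a) x ->
  forall b, F b x <-> ord_lt b (ord_succ a).
Proof.
move=> ax nax b; split=> [bx|/ord_lt_succ[ba|->//]]; last first.
  exact: ulm_filtration_anti ba _ ax.
case: (ord_lt_total b (ord_succ a)) => [//|bE|ab].
  by case: nax; rewrite -bE.
by case: nax; apply: ulm_filtration_anti ab _ bx.
Qed.

Lemma filtration_linear (f : {linear A -> A}) a x : F a x -> F a (f x).
Proof.
elim/(well_founded_ind ord_lt_wf): a x => a IH x.
rewrite [F a]ulm_filtrationE => -[xS xL]; split=> [b ba ab|la b ba].
  have [y yb <-] := xS b ba ab; exists (f y); first exact: IH.
  by rewrite linearZ.
by apply: IH => //; apply: xL.
Qed.

(** The nonvanishing of the [a]-th Ulm invariant, without a basis. *)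
Definition has_socle_height a : Prop :=
  exists2 u, @socle_filtration _ p A a u & ~ F (ord_succ a) u.

(** A jump of more than one in height, from [x] to [p x], is caused by a socle
    element of the height of [x]. *)
Lemma height_gap a x : F a x -> F (ord_succ (ord_succ a)) (p *: x) ->
  exists v, [/\ F (ord_succ a) v, p *: v = p *: x & @socle_filtration _ p A a (x - v)].
Proof.
rewrite {1}[F (ord_succ (ord_succ a))]ulm_filtrationS => ax [v av vx].
exists v; split=> //; split; first by rewrite /socle /= scalerBr vx subrr.
by apply: submoduleB => //; apply: filtrationSS.
Qed.

Hypotheses (pP : uniformizer p) (redA : reduced A).

(** The intersection of the filtration is divisible by [p], hence a divisible
    submodule. *)
Lemma filtration_core x : (forall a, F a x) -> x = 0.
Proof.
move=> xF; pose D := [set y | forall a, F a y].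
suff : D = [set 0] by move=> D0; have : D x by []; rewrite D0.
apply: redA.
  apply/submoduleP; split=> [a|r y z Dy Dz a]; first exact: submodule0.
  by apply: submoduleD => //; apply: submoduleZ.
have pD n y : D y -> exists2 z, D z & p ^+ n *: z = y.
  elim: n y => [|n IH] y Dy; first by exists y; rewrite // expr0 scale1r.
  have [z Dz <-] := ulm_filtration_core_divisible Dy.
  have [w Dw <-] := IH z Dz.
  by exists w => //; rewrite exprS scalerA.
move=> r r0 y Dy; have [n [u uU rE]] := pP.2 r r0.
have [|z Dz zE] := pD n (u^-1 *: y).
  by move=> a; apply: submoduleZ.
by exists z => //; rewrite rE -scalerA zE scalerA divrr // scale1r.
Qed.

Lemma height_ex x : x <> 0 -> exists2 a, F a x & ~ F (ord_succ a) x.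
Proof.
move=> x0; apply: contrapT => N; apply: x0; apply: filtration_core.
apply: ulm_filtration_core => a ax; apply: contrapT => nax; apply: N.
by exists a.
Qed.

End Filtration.

(** * Elements of maximal height in a coset *)

(** The coset [x + S] has a representative lying in as many members as possible
    of a chain [F] of submodules. *)
Lemma coset_max_height (R : nzRingType) (A : lmodType R) (I : Type)
    (F : I -> set A) (S : set A) (x : A) :
  (forall i, submodule (F i)) -> (forall i j, F i `<=` F j \/ F j `<=` F i) ->
  submodule S -> dcc S ->
  exists2 s, S s & forall s', S s' -> forall i, F i (x + s') -> F i (x + s).
Proof.
move=> sF Ftot sS dS; apply: contrapT => N.
(* Otherwise representatives of strictly increasing height yield a strictly
   decreasing sequence of submodules [S `&` F i]. *)
have step (s : {s | S s}) : {s' : {s | S s} | exists i,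
    F i (x + sval s') /\ ~ F i (x + sval s)}.
  apply: cid; apply: contrapT => M; apply: N; exists (sval s); first exact: svalP.
  move=> s' Ss' i Fs'; apply: contrapT => nFs; apply: M.
  by exists (exist _ s' Ss'), i.
have [f [_ fS]] := dependent_choice step (exist _ 0 (submodule0 sS)).
have {}fS n : {i | F i (x + sval (f n.+1)) /\ ~ F i (x + sval (f n))}.
  exact: cid.
pose i n := sval (fS n).
have Fi n : F (i n) (x + sval (f n.+1)) by case: (svalP (fS n)).
have nFi n : ~ F (i n) (x + sval (f n)) by case: (svalP (fS n)).
have iS n : F (i n.+1) `<=` F (i n).
  by case: (Ftot (i n.+1) (i n)) => // /(_ _ (Fi n)) /nFi.
have [|n y []//|n y [Sy /iS]//|N' HN] := dS (fun n => S `&` F (i n)).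
  by move=> n; apply: submoduleI.
pose d := sval (f N'.+2) - sval (f N'.+1).
have dE : d = (x + sval (f N'.+2)) - (x + sval (f N'.+1)).
  by rewrite opprD addrACA subrr add0r.
have dN : (S `&` F (i N')) d.
  split; first by apply: submoduleB => //; apply: svalP.
  by rewrite dE; apply: submoduleB => //; apply: iS; apply: Fi.
have [_ dN'] := HN N'.+1 (leqnSn _) _ dN; apply: (nFi N'.+1).
rewrite -[x + _](subKr (x + sval (f N'.+2))) -dE.
exact: submoduleB.
Qed.

(** * Partial maps *)

Section PartialMaps.
Variables (R : idomainType) (p : R) (A : lmodType R).
Local Notation F := (@ulm_filtration _ p A).
Let sF := @ulm_filtration_submodule R p A.
Let Ftot := @filtration_total R p A.
Implicit Types (a b : ord) (x y s t w : A) (G : set (A * A)).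

(** A submodule [G] of [A * A] stands for a partial homomorphism on [A]; [dom G]
    and [dom (swap G)] are its domain and its range. *)
Definition dom G : set A := [set s | exists t, G (s, t)].

Definition swap G : set (A * A) := [set u | G (u.2, u.1)].

(** [G] does not decrease heights.  In a reduced module this makes [G]
    single-valued. *)
Definition height_nondecr G : Prop := forall a s t, G (s, t) -> F a s -> F a t.

Lemma swap_submodule G : submodule G -> submodule (swap G).
Proof.
move=> /submoduleP[G0 GL]; apply/submoduleP; split=> //.
by move=> r [x x'] [y y']; apply: GL.
Qed.

Lemma swap_dcc G : dcc G -> dcc (swap G).
Proof.
move=> dG D sD DG dD.
have [n|n u|n u|N HN] := dG (fun n => swap (D n)).
- exact: swap_submodule.
- by move=> /DG; rewrite /swap /= -surjective_pairing.
- exact: dD.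
- by exists N => n /HN H [x y]; apply: (H (y, x)).
Qed.

Lemma swap_adjoin G x w : swap (adjoin G (x, w)) = adjoin (swap G) (w, x).
Proof.
apply/seteqP; split=> -[u v] [[d e] [r [Gd [-> ->]]]];
  by exists (e, d), r.
Qed.

Lemma dom_submodule G : submodule G -> submodule (dom G).
Proof.
move=> /submoduleP[G0 GL]; apply/submoduleP; split; first by exists 0.
by move=> r x y [x' Gx] [y' Gy]; exists (r *: x' + y'); apply: (GL r _ _ Gx Gy).
Qed.

Lemma dom_dcc G : submodule G -> dcc G -> dcc (dom G).
Proof.
move=> sG dG D sD DG dD.
have [n|n u []//|n u [Gu /dD]//|N HN] := dG (fun n => G `&` [set u : A * A | D n u.1]).
  apply: submoduleI => //; apply/submoduleP.
  split; first exact: (submodule0 (sD n)).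
  by move=> r x y Dx Dy; apply: (submoduleD (sD n)) => //; apply: (submoduleZ _ (sD n)).
exists N => n /HN H x Dx; have [y Gxy] := DG _ _ Dx.
by have [] := H (x, y) (conj Gxy Dx).
Qed.

Hypothesis pP : uniformizer p.

(** The hypothesis on [x] says that it has height [a] and that this is the maximal
    height in its coset modulo [dom G]: the height of [s + x] is then the minimum
    of [a] and the height of [s]. *)
Lemma adjoin_height_nondecr G x w a : submodule G -> height_nondecr G ->
  G (p *: x, p *: w) -> F a x -> F a w ->
  (forall s, dom G s -> ~ F (ord_succ a) (s + x)) ->
  height_nondecr (adjoin G (x, w)).
Proof.
move=> sG hG Gp ax aw xP b u v [[s t] [r [Gst [-> ->]]]].
have [/principal_idealP[c ->]|/(uniformizer_unit pP) rU] :=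
    pselect (principal_ideal p r).
  rewrite -!scalerA; apply: hG.
  exact: (submoduleD sG Gst (submoduleZ c sG Gp)).
have unitE z y : z + r *: y = r *: (r^-1 *: z + y).
  by rewrite scalerDr scalerA divrr // scale1r.
have Gst' : G (r^-1 *: s, r^-1 *: t) := submoduleZ r^-1 sG Gst.
rewrite [s + _]unitE [t + _]unitE => bs; apply: submoduleZ => //.
have {bs}: F b (r^-1 *: s + x).
  by rewrite -[_ + x]scale1r -(mulVr rU) -scalerA; apply: submoduleZ.
move: (r^-1 *: s) (r^-1 *: t) Gst' => {Gst unitE}s {}t Gst bs.
have ns : ~ F (ord_succ a) (s + x) by apply: xP; exists t.
have ab : F a `<=` F b.
  case: (ord_lt_total b (ord_succ a)) => [|bE|ab].
  - by move=> /ord_lt_succ[/ulm_filtration_anti//|->].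
  - by case: ns; rewrite -bE.
  - by case: ns; apply: ulm_filtration_anti ab _ bs.
apply: submoduleD => //; last exact: ab.
apply: hG Gst _; rewrite -(addrK x s); apply: submoduleB => //; exact: ab.
Qed.

(** A partial homomorphism on an artinian submodule, not decreasing heights. *)
Definition partial_hom G : Prop :=
  [/\ submodule G, dcc G & height_nondecr G].

(** A partial isomorphism between artinian submodules, preserving heights. *)
Definition partial_iso G : Prop := partial_hom G /\ height_nondecr (swap G).

Lemma partial_iso_swap G : partial_iso G -> partial_iso (swap G).
Proof.
move=> [[sG dG hG] hG']; split; first by split=> //; [apply: swap_submodule|apply: swap_dcc].
by move=> a s t; apply: hG.
Qed.

Hypothesis redA : reduced A.

Lemma height_nondecr_functional G s t t' : submodule G -> height_nondecr G ->
  G (s, t) -> G (s, t') -> t = t'.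
Proof.
move=> sG hG Gt Gt'; apply/eqP; rewrite -subr_eq0; apply/eqP.
apply: (filtration_core pP redA) => a; apply: (hG a 0); last exact: submodule0.
by have := submoduleB sG Gt Gt'; rewrite /= -[_ - _]/(s - s, t - t') subrr.
Qed.

Lemma partial_hom_forth G x : partial_hom G -> dom G (p *: x) ->
  exists G', [/\ partial_hom G', G `<=` G' & dom G' x].
Proof.
move=> [sG dG hG] [z Gz].
have [Gx|nGx] := pselect (dom G x); first by exists G; split=> //; split.
have sS := dom_submodule sG; have dS := dom_dcc sG dG.
have [s0 Ss0 max0] := coset_max_height x sF Ftot sS dS.
have [t0 Gst0] := Ss0.
have [|a ax nax] := @height_ex _ p A pP redA (x + s0).
  move=> E; apply: nGx; rewrite -(addrK s0 x) E sub0r; exact: submoduleN.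
have Gpx : G (p *: (x + s0), z + p *: t0).
  by rewrite scalerDr; apply: (submoduleD sG Gz (submoduleZ p sG Gst0)).
have : F (ord_succ a) (z + p *: t0) by apply: hG Gpx _; apply: filtration_scale.
rewrite ulm_filtrationS => -[w aw wE].
exists (adjoin G (x + s0, w)); rewrite -wE in Gpx; split.
- split; [exact: adjoin_submodule|exact: (@dcc_adjoin _ _ pP _ G (_, _) sG Gpx dG)|].
  apply: adjoin_height_nondecr (hG) (Gpx) ax aw _ => // s Ss.
  by rewrite addrCA [s + _]addrC => /max0 H; apply: nax; apply: H; apply: submoduleD.
- exact: sub_adjoin.
- exists (w - t0).
  have := submoduleB (adjoin_submodule _ sG) (adjoin_mem _ sG) (sub_adjoin (x + s0, w) Gst0).
  by rewrite -[_ - _]/(x + s0 - s0, w - t0) addrK.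
Qed.

(** If some socle element of height [a] is not congruent modulo [F (a + 1)] to
    an element of the domain of a partial isomorphism, the same holds for its
    range.  This is the point where Kaplansky and Mackey compare two dimensions
    over the residue field; here it is an instance of the fact that an injective
    endomorphism of an artinian module is surjective. *)
Lemma partial_iso_exchange G a u0 : partial_iso G -> @socle_filtration _ p A a u0 ->
  (forall s, dom G s -> ~ F (ord_succ a) (u0 + s)) ->
  exists2 u, @socle_filtration _ p A a u &
    forall t, dom (swap G) t -> ~ F (ord_succ a) (t + u).
Proof.
move=> [[sG dG hG] hG'] [pu0 au0] u0P; apply: contrapT => N.
have full u : @socle_filtration _ p A a u ->
    exists2 t, dom (swap G) t & F (ord_succ a) (u - t).
  move=> ua; apply: contrapT => M; apply: N; exists u => // t tG atu.
  apply: M; exists (- t); last by rewrite opprK addrC.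
  by apply: submoduleN => //; apply/dom_submodule/swap_submodule.
(* [Q] is the sum of the socle filtration at [a] and [F (a + 1)]. *)
pose Q := [set y | F a y /\ F (ord_succ (ord_succ a)) (p *: y)].
have sQ : submodule Q.
  apply/submoduleP; split; first by rewrite /Q /= scaler0; split; apply: submodule0.
  move=> r y z [ya py] [za pz]; split.
    by apply: submoduleD => //; apply: submoduleZ.
  rewrite scalerDr scalerA mulrC -scalerA.
  by apply: submoduleD => //; apply: submoduleZ.
have QG s t : G (s, t) -> Q s <-> Q t.
  move=> Gst; have Gpst : G (p *: s, p *: t) := submoduleZ p sG Gst.
  by split=> -[ya py]; split; [apply: hG ya|apply: hG py|apply: hG' ya|apply: hG' py].
have QF y : F (ord_succ a) y -> Q y.
  by move=> ay; split; [apply: filtrationSS|apply: filtration_scale].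
have Qt y : Q y -> exists2 t, dom (swap G) t & F (ord_succ a) (y - t).
  move=> [ay py]; have [v [av vE /full[t Gt atv]]] := height_gap ay py.
  exists t => //; rewrite -(subrK v (y - t)); apply: submoduleD => //.
  by rewrite addrAC.
(* [W n] is, modulo [F (a + 1)], the image of the [n]-th iterate of the
   injective map induced by the inverse of [G]. *)
pose W := fix W n : set A := if n is m.+1 then
    [set y | exists s t, [/\ G (s, t), W m t & F (ord_succ a) (y - s)]] else Q.
have sW n : submodule (W n).
  elim: n => [//|n IH]; apply/submoduleP; split.
    by exists 0, 0; rewrite subr0; split; [exact: (submodule0 sG)|exact: submodule0..].
  move=> r y y' [s [t [Gst Wt sy]]] [s' [t' [Gst' Wt' sy']]].
  exists (r *: s + s'), (r *: t + t'); split.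
  - exact: (submoduleD sG (submoduleZ r sG Gst) Gst').
  - by apply: submoduleD => //; apply: submoduleZ.
  - rewrite opprD addrACA -scalerBr.
    by apply: submoduleD => //; apply: submoduleZ.
have WF n y : F (ord_succ a) y -> W n y.
  case: n => [|n] ay; first exact: QF.
  by exists 0, 0; rewrite subr0; split=> //; [exact: (submodule0 sG)|exact: submodule0].
have W1 : W 1%N `<=` W 0%N.
  move=> y [s [t [Gst /(QG _ _ Gst) Qs ys]]].
  by rewrite -(subrK s y); apply: submoduleD => //; apply: QF.
have dW n : W n.+1 `<=` W n.
  elim: n => [//|n IH] y [s [t [Gst Wt ys]]]; exists s, t; split=> //.
  exact: IH.
have WQ n : W n `<=` Q by move=> y; apply: (decr_chain dW (leq0n n)).
have [N' HN] : exists N', W N' `<=` W N'.+1.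
  have := dom_dcc (swap_submodule sG) (swap_dcc dG).
  move=> /(_ (fun n => dom (swap G) `&` W n))[n|n y []//|n y [Gy /dW]//|N' HN].
    by apply: submoduleI => //; apply/dom_submodule/swap_submodule.
  exists N' => y Wy; have [t Gt ayt] := Qt y (WQ _ _ Wy).
  rewrite -(subrK t y); apply: submoduleD => //; first exact: WF.
  suff /(HN N'.+1 (leqnSn _))[] : (dom (swap G) `&` W N') t by [].
  by split=> //; rewrite -(subKr y t); apply: submoduleB => //; apply: WF.
(* Stabilization propagates downwards, the induced map being injective. *)
have {N' HN} : W 0%N `<=` W 1%N.
  elim: N' HN => [//|n IH] HN; apply: IH => y Wy.
  have [t [s Gst] ayt] := Qt y (WQ _ _ Wy).
  have Wt : W n t by rewrite -(subKr y t); apply: submoduleB => //; apply: WF.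
  have [|s' [t' [Gst' Wt' ss']]] := HN s.
    by exists s, t; rewrite subrr; split=> //; apply: submodule0.
  rewrite -(subrK t y); apply: submoduleD => //; first exact: WF.
  rewrite -(subrK t' t); apply: submoduleD => //; apply: WF.
  exact: (hG _ _ _ (submoduleB sG Gst Gst')).
case/(_ u0) => [|s [t [Gst _ us]]].
  by split=> //; rewrite pu0; apply: submodule0.
apply: (u0P (- s)) => //; apply: submoduleN; first exact: dom_submodule.
by exists t.
Qed.

Lemma partial_iso_forth G x : partial_iso G -> dom G (p *: x) ->
  exists G', [/\ partial_iso G', G `<=` G' & dom G' x].
Proof.
move=> iG Gpx; have [[sG dG hG] hG'] := iG.
have [Gx|nGx] := pselect (dom G x); first by exists G; split=> //; split.
have sS := dom_submodule sG; have dS := dom_dcc sG dG.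
have [s0 Ss0 max0] := coset_max_height x sF Ftot sS dS.
have [|a ax nax] := @height_ex _ p A pP redA (x + s0).
  move=> E; apply: nGx; rewrite -(addrK s0 x) E sub0r; exact: submoduleN.
(* Among the elements of height [a] in the coset, maximize the height of the
   multiple by [p]. *)
have [s1 [Ss1 as1] max1] : exists2 s, (dom G `&` F a) s &
    forall s', (dom G `&` F a) s' -> forall b,
      F b (p *: (x + s0 + s')) -> F b (p *: (x + s0 + s)).
  apply: (@coset_max_height _ _ _ (fun b => [set y | F b (p *: y)])).
  - move=> b; apply/submoduleP; split; first by rewrite /= scaler0; apply: submodule0.
    move=> r y z py pz; rewrite /= scalerDr scalerA mulrC -scalerA.
    by apply: submoduleD => //; apply: submoduleZ.
  - by move=> b c; case: (Ftot b c) => bc; [left|right] => y; apply: bc.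
  - exact: submoduleI.
  - by apply: dcc_sub dS => y [].
have Ss01 : dom G (s0 + s1) by apply: submoduleD.
have x1P s : dom G s -> ~ F (ord_succ a) (s + (x + s0 + s1)).
  move=> Ss; rewrite -addrA [s + _]addrCA => H.
  exact: nax (max0 _ (submoduleD sS Ss Ss01) _ H).
have ax1 : F a (x + s0 + s1) by apply: submoduleD.
have pmax s : dom G s -> F a s -> forall b,
    F b (p *: (s + (x + s0 + s1))) -> F b (p *: (x + s0 + s1)).
  move=> Ss sa b; rewrite addrC -addrA; apply: max1.
  by split; [apply: submoduleD|apply: submoduleD].
have [t01 Gt01] := Ss01.
have [z Gz] : dom G (p *: (x + s0 + s1)).
  by rewrite -addrA scalerDr; apply: submoduleD => //; apply: submoduleZ.
suff [w [aw wE wP]] : exists w, [/\ F a w, p *: w = z &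
    forall t, dom (swap G) t -> ~ F (ord_succ a) (t + w)].
  exists (adjoin G (x + s0 + s1, w)); rewrite -{}wE in Gz; split.
  - split; first split; [exact: adjoin_submodule|exact: (@dcc_adjoin _ _ pP _ G (_, _) sG Gz dG)| |].
      exact: adjoin_height_nondecr Gz ax1 aw x1P.
    rewrite swap_adjoin; apply: adjoin_height_nondecr aw ax1 wP => //.
    exact: swap_submodule.
  - exact: sub_adjoin.
  - exists (w - t01).
    have := submoduleB (adjoin_submodule _ sG) (adjoin_mem _ sG)
      (sub_adjoin (x + s0 + s1, w) Gt01).
    by rewrite -[_ - _]/(x + s0 + s1 - (s0 + s1), w - t01) -addrA addrK.
move: (x + s0 + s1) Gz ax1 x1P pmax => x1 Gz ax1 x1P pmax.
(* With a gap above [a], correct a preimage of [z] in [F (a + 1)] by a socle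
   element; without one, any preimage of [z] in [F a] has the required property,
   by the maximality of the height of [p *: x1]. *)
have [apx|napx] := pselect (F (ord_succ (ord_succ a)) (p *: x1)).
  have [v [av vE uS]] := height_gap ax1 apx.
  have := hG _ _ _ Gz apx; rewrite ulm_filtrationS => -[w' aw' <-].
  have [|u [pu au] uP] := partial_iso_exchange iG uS.
    move=> s Ss aus; apply: (x1P s Ss); rewrite -(subrK v x1) addrC addrAC.
    exact: submoduleD.
  exists (u + w'); split.
  - by apply: submoduleD => //; apply: filtrationSS.
  - by rewrite scalerDr pu add0r.
  - move=> t Gt atu; apply: (uP t Gt).
    by rewrite -(addrK w' (t + u)) -[t + u + w']addrA; apply: submoduleB.
have := hG _ _ _ Gz (filtration_scale ax1); rewrite {1}ulm_filtrationS => -[w aw wE].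
exists w; split=> // t [s Gst] atw; apply: napx.
have ta : F a t by rewrite -(addrK w t); apply: submoduleB => //; apply: filtrationSS.
apply: (pmax s); first by exists t.
  exact: hG' ta.
apply: (hG' _ (p *: (t + w))); last exact: filtration_scale.
rewrite /swap /= !scalerDr wE.
exact: (submoduleD sG (submoduleZ p sG Gst) Gz).
Qed.

End PartialMaps.

(** * Back and forth *)

(** One application of the step for each [n] yields an increasing sequence of
    conditions, the [n.+1]-st meeting the [n]-th requirement. *)
Lemma chain_of_extensions (T : Type) (P : set T -> Prop) (Q : nat -> set T -> Prop) :
  (forall n G, P G -> exists G', [/\ P G', G `<=` G' & Q n G']) ->
  forall G, P G -> exists H : nat -> set T, [/\ H 0%N = G, forall n, P (H n),
    forall n, H n `<=` H n.+1 & forall n, Q n (H n.+1)].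
Proof.
move=> ext G PG.
have step n (S : {G | P G}) : {S' : {G | P G} | sval S `<=` sval S' /\ Q n (sval S')}.
  by apply: cid; have [G' [PG' SG' QG']] := ext n _ (svalP S); exists (exist _ G' PG').
pose H := fix H n : {G | P G} :=
  if n is m.+1 then sval (step m (H m)) else exist _ G PG.
exists (fun n => sval (H n)); split=> // n.
- exact: svalP.
- by case: (svalP (step n (H n))).
- by case: (svalP (step n (H n))).
Qed.

Section BackAndForth.
Variables (R : idomainType) (p : R) (A : lmodType R).
Local Notation F := (@ulm_filtration _ p A).
Let sF := @ulm_filtration_submodule R p A.
Implicit Types (a b : ord) (x y s t w : A) (G : set (A * A)).

Hypotheses (pP : uniformizer p) (torsA : torsion A) (redA : reduced A).

(** In a torsion module the step from [p x] to [x] suffices to reach every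
    element. *)
Lemma forth_torsion (P : set (A * A) -> Prop) :
  (forall G, P G -> submodule G) ->
  (forall G x, P G -> dom G (p *: x) ->
    exists G', [/\ P G', G `<=` G' & dom G' x]) ->
  forall G x, P G -> exists G', [/\ P G', G `<=` G' & dom G' x].
Proof.
move=> sP forth G x PG; have [n pn0] := torsion_power pP torsA x.
have : dom G (p ^+ n *: x) by rewrite pn0; apply: submodule0; apply/dom_submodule/sP.
elim: n x {pn0} => [|n IH] x; first by rewrite expr0 scale1r => Gx; exists G; split.
rewrite exprSr -scalerA => /IH[G' [PG' GG' G'px]].
have [G'' [PG'' G'G'' G''x]] := forth _ _ PG' G'px.
by exists G''; split=> //; apply: subset_trans G'G''.
Qed.

Lemma cyclic_height_nondecr x y :
  (forall i a, F a (p ^+ i *: x) -> F a (p ^+ i *: y)) ->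
  height_nondecr p (adjoin [set 0] (x, y)).
Proof.
move=> xy a s t [[d e] [r [[-> ->] [-> ->]]]]; rewrite /= !add0r.
have [->|r0] := eqVneq r 0; first by rewrite !scale0r.
have [n [u uU ->]] := pP.2 r r0; rewrite -!scalerA => H.
apply: submoduleZ => //; apply: xy.
rewrite -[X in F a X]scale1r -(mulVr uU) -scalerA; exact: submoduleZ.
Qed.

Lemma cyclic_partial_hom x y :
  (forall i a, F a (p ^+ i *: x) -> F a (p ^+ i *: y)) ->
  partial_hom p (adjoin [set 0] (x, y)).
Proof.
move=> xy; have s0 := @submodule_zero _ (A * A)%type.
split; [exact: adjoin_submodule| |exact: cyclic_height_nondecr].
have [n pn] := torsion_power pP torsA x; have [m pm] := torsion_power pP torsA y.
apply: (@dcc_adjoin_power _ _ pP _ (n + m)) (@dcc0 _ _) => //.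
apply/pair_equal_spec; split=> /=.
  by rewrite addnC exprD -scalerA pn scaler0.
by rewrite exprD -scalerA pm scaler0.
Qed.

Lemma linear_of_graph G : submodule G -> height_nondecr p G ->
  (forall x, dom G x) -> exists f : {linear A -> A}, forall x, G (x, f x).
Proof.
move=> sG hG tG; pose f x := sval (cid (tG x)).
have fG x : G (x, f x) by rewrite /f; case: cid.
have lf : linear f.
  move=> r x y; apply: (height_nondecr_functional pP redA sG hG (fG _)).
  exact: (submoduleD sG (submoduleZ r sG (fG x)) (fG y)).
pose m := GRing.isLinear.Build R A A _ f lf.
by exists (HB.pack_for {linear A -> A} f m).
Qed.

Lemma chain_union_submodule (H : nat -> set (A * A)) :
  (forall n, submodule (H n)) -> (forall n, H n `<=` H n.+1) ->
  submodule [set u | exists n, H n u].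
Proof.
move=> sH HS; have Hle n m : (n <= m)%N -> H n `<=` H m.
  elim: m => [|m IH]; first by rewrite leqn0 => /eqP->.
  rewrite leq_eqVlt => /orP[/eqP->//|/IH nm]; exact: subset_trans (HS m).
apply/submoduleP; split; first by exists 0%N; apply: submodule0.
move=> r x y [n nx] [m my]; exists (maxn n m).
apply: submoduleD; [exact: sH| |exact: Hle (leq_maxr _ _) _ my].
by apply: submoduleZ; [exact: sH|exact: Hle (leq_maxl _ _) _ nx].
Qed.

Hypothesis cgA : countably_generated A.

(** Full transitivity: degeneration is the termwise comparison of Ulm sequences. *)
Lemma degeneratesP x y : degenerates x y <->
  forall i a, F a (p ^+ i *: x) -> F a (p ^+ i *: y).
Proof.
split=> [[f <-] i a ax|xy]; first by rewrite -linearZ; apply: filtration_linear.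
have [g gP] := cgA.
have [H [H0 PH HS HQ]] := @chain_of_extensions _ (@partial_hom _ p A) (fun n G => dom G (g n))
  (fun n G => @forth_torsion _ (fun G PG => let: And3 sG _ _ := PG in sG)
     (fun G x => @partial_hom_forth _ _ _ pP redA G x) G (g n)) _ (cyclic_partial_hom xy).
pose U := [set u | exists n, H n u].
have sU : submodule U by apply: chain_union_submodule => // n; case: (PH n).
have hU : height_nondecr p U.
  by move=> a s t [n Hst]; have [_ _ hH] := PH n; apply: hH Hst.
have tU z : dom U z.
  have [n [r ->]] := gP z; apply: submodule_sum; first exact: dom_submodule.
  by move=> i; have [t Ht] := HQ i; exists t, i.+1.
have [f fU] := linear_of_graph sU hU tU; exists f.
apply: (height_nondecr_functional pP redA sU hU (fU x)).
by exists 0%N; rewrite H0; apply: adjoin_mem; apply: submodule_zero.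
Qed.

(** Transitivity: elements with the same Ulm sequence are conjugate under
    automorphisms. *)
Lemma automorphism_exists x y :
  (forall i a, F a (p ^+ i *: x) <-> F a (p ^+ i *: y)) ->
  exists2 f : {linear A -> A}, bijective f & f x = y.
Proof.
move=> xy; have [g gP] := cgA.
have P0 : partial_iso p (adjoin [set 0] (x, y)).
  split; first by apply: cyclic_partial_hom => i a /xy.
  have -> : swap (adjoin [set 0] (x, y)) = adjoin [set 0] (y, x).
    rewrite swap_adjoin; congr adjoin.
    by apply/seteqP; split=> -[u v]; rewrite /swap /= => -[-> ->].
  by apply: cyclic_height_nondecr => i a /xy.
have forth := @forth_torsion _ (fun G (PG : partial_iso p G) => let: And3 sG _ _ := PG.1 in sG)
  (fun G x => @partial_iso_forth _ _ _ pP redA G x).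
have step n G : partial_iso p G -> exists G',
    [/\ partial_iso p G', G `<=` G' & dom G' (g n) /\ dom (swap G') (g n)].
  move=> PG; have [G1 [PG1 GG1 [t G1g]]] := forth G (g n) PG.
  have [G2 [PG2 G1G2 G2g]] := forth (swap G1) (g n) (partial_iso_swap PG1).
  exists (swap G2); split; first exact: partial_iso_swap.
    by move=> [u v] /GG1 ?; apply: (G1G2 (v, u)).
  by split=> //; exists t; apply: (G1G2 (t, g n)).
have [H [H0 PH HS HQ]] := chain_of_extensions step P0.
pose U := [set u | exists n, H n u].
have sU : submodule U by apply: chain_union_submodule => // n; case: (PH n) => -[].
have hU : height_nondecr p U.
  by move=> a s t [n Hst]; have [[_ _ hH] _] := PH n; apply: hH Hst.
have hU' : height_nondecr p (swap U).
  by move=> a s t [n Hst]; have [_ hH] := PH n; apply: hH Hst.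
have sU' := swap_submodule sU.
have [f fU] : exists f : {linear A -> A}, forall z, U (z, f z).
  apply: linear_of_graph => // z; have [n [r ->]] := gP z.
  apply: submodule_sum; first exact: dom_submodule.
  by move=> i; have [[t Ht] _] := HQ i; exists t, i.+1.
have [h hhU] : exists h : {linear A -> A}, forall z, swap U (z, h z).
  apply: linear_of_graph => // z; have [n [r ->]] := gP z.
  apply: submodule_sum; first exact: dom_submodule.
  by move=> i; have [_ [t Ht]] := HQ i; exists t, i.+1.
exists f.
  exists h => z.
    exact: (height_nondecr_functional pP redA sU' hU' (hhU _) (fU z)).
  exact: (height_nondecr_functional pP redA sU hU (fU _) (hhU z)).
apply: (height_nondecr_functional pP redA sU hU (fU x)).
by exists 0%N; rewrite H0; apply: adjoin_mem; apply: submodule_zero.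
Qed.

Lemma to_orbitsP x y : to_orbits x = to_orbits y <->
  forall i a, F a (p ^+ i *: x) <-> F a (p ^+ i *: y).
Proof.
split=> [E i a|xy].
  split; apply: (degeneratesP _ _).1; apply: orbit_eq_degenerates => //.
have orbS z w : (forall i a, F a (p ^+ i *: z) <-> F a (p ^+ i *: w)) ->
    Defs.orbit z `<=` Defs.orbit w.
  move=> zw _ [f [f' ff' f'f] <-].
  have [|h [h' hh' h'h] hw] := @automorphism_exists w z.
    by move=> i a; split=> /zw.
  exists (f \o h : {linear A -> A}); last by rewrite /= hw.
  by exists (h' \o f'); [exact: can_comp|exact: can_comp].
apply: eq_exist; apply/seteqP; split; apply: orbS => // i a.
by split=> /xy.
Qed.

End BackAndForth.

(** * Nonvanishing Ulm invariants *)

Section UlmPositive.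
Variables (R : idomainType) (p : R) (A : lmodType R).
Local Notation F := (@ulm_filtration _ p A).
Local Notation P := (@socle_filtration _ p A).
Hypothesis pP : uniformizer p.
Implicit Types (a : ord) (x : A) (B : set A).

Lemma socle_filtration_submodule a : submodule (P a).
Proof.
apply: submoduleI; last exact: ulm_filtration_submodule.
apply/submoduleP; split; first by rewrite /socle /= scaler0.
move=> r x y; rewrite /socle /= => px py.
by rewrite scalerDr scalerA mulrC -scalerA px py scaler0 addr0.
Qed.

Let sP := socle_filtration_submodule.

(** [B] is linearly independent in [P a / P (a + 1)] over the residue field. *)
Definition socle_independent a B : Prop :=
  B `<=` P a /\
  forall n (k : 'I_n -> A) (r : 'I_n -> R), injective k -> (forall i, B (k i)) ->
    P (ord_succ a) (\sum_(i < n) r i *: k i) -> forall i, principal_ideal p (r i).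

(** The inverse image in [A] of the subspace of [P a / P (a + 1)] spanned by [B],
    for [B] contained in [P a]. *)
Definition socle_span a B : set A := [set x | exists n (k : 'I_n -> A) (r : 'I_n -> R),
  (forall i, B (k i)) /\ P (ord_succ a) (x - \sum_(i < n) r i *: k i)].

Lemma socle_independent_setU1 a B x : socle_independent a B -> P a x ->
  ~ socle_span a B x -> socle_independent a (x |` B).
Proof.
move=> [BP indB] xP xB; split=> [y [->//|/BP//]|n k r injk kB rP].
have [[j kj]|nj] := pselect (exists j, k j = x); last first.
  apply: (indB n k r) => // i; case: (kB i) => // kix.
  by case: nj; exists i.
case: n k r injk kB rP j kj => [|n] k r injk kB rP j kj; first by case: j kj.
have kB' i : B (k (lift j i)).
  case: (kB (lift j i)) => // kix.
  have /injk/eqP : k (lift j i) = k j by rewrite kj.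
  by rewrite eq_sym (negPf (neq_lift _ _)).
move: rP; rewrite (bigD1_ord j) //= kj => rP.
have [/principal_idealP[c rj]|/(uniformizer_unit pP) rjU] :=
    pselect (principal_ideal p (r j)); last first.
  case: xB; exists n, (fun i => k (lift j i)), (fun i => - ((r j)^-1 * r (lift j i))).
  split=> //; have := submoduleZ (r j)^-1 (sP _) rP.
  rewrite scalerDr scalerA mulVr // scale1r scaler_sumr -sumrN.
  by under [in X in _ -> X]eq_bigr do rewrite scaleNr opprK -scalerA.
have px : p *: x = 0 by case: xP.
move: rP; rewrite {1}rj -scalerA px scaler0 add0r => rP i.
case: (unliftP j i) => [i' ->|->]; last by apply/principal_idealP; exists c.
apply: (indB n (fun i => k (lift j i)) (fun i => r (lift j i))) => // i1 i2 /injk.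
exact: lift_inj.
Qed.

Lemma socle_basis a : exists2 B, socle_independent a B & P a `<=` socle_span a B.
Proof.
have [|B [indB maxB]] := @Zorn_bigcup _ (socle_independent a).
  move=> C CI totC; split=> [x [X CX Xx]|n k r injk kC rP i].
    by have [XP _] := CI X CX; apply: XP.
  have [X [CX Xs]] : exists X, C X /\ forall j, X (k j).
    suff [X [CX Xs]] : exists X, C X /\ {in enum 'I_n, forall j, X (k j)}.
      by exists X; split=> // j; apply: Xs; rewrite mem_enum.
    elim: (enum 'I_n) => [|j s [X [CX Xs]]]; first by have [X CX _] := kC i; exists X.
    have [Y CY Yj] := kC j; have [XY|YX] := totC X Y CX CY.
      exists Y; split=> // l; rewrite inE => /predU1P[->//|/Xs]; exact: XY.
    exists X; split=> // l; rewrite inE => /predU1P[->|/Xs//]; exact: YX.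
  by have [_ indX] := CI X CX; apply: (indX n k r).
exists B => // x xP; apply: contrapT => xB.
apply: (maxB (x |` B)); last exact: socle_independent_setU1.
split; first by move=> y By; right.
move=> /(_ x (or_introl erefl)) Bx; apply: xB.
exists 1%N, (fun=> x), (fun=> 1); split=> //.
by rewrite big_ord1 scale1r subrr; apply: submodule0.
Qed.

Lemma ulm_invariant_positiveP a :
  ulm_invariant_positive p A a <-> has_socle_height p A a.
Proof.
split=> [[K [[k] [e [eP eI _]]]]|[u uP nu]].
  exists (e k) => // ek; apply: (uniformizer_not1 pP).
  apply: (eI 1%N (fun=> k) (fun=> 1) _ _ ord0).
    by move=> i j _; rewrite !ord1.
  by rewrite big_ord1 scale1r; split=> //; case: (eP k).
have [B [BP indB] spanB] := socle_basis a.
have [k0] : inhabited {x | B x}.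
  have [n [k [r [kB [_ uk]]]]] := spanB u uP.
  case: n k r kB uk => [|n] k r kB uk.
    by case: nu; rewrite big_ord0 subr0 in uk.
  by constructor; exists (k ord0).
exists {x | B x}; split=> //; exists sval; split.
- by move=> k; apply: BP; apply: svalP.
- move=> n k r injk; apply: indB; last by move=> i; apply: svalP.
  by move=> i j kij; apply: injk; case: (k i) (k j) kij => [u' Bu] [v' Bv]; apply: eq_exist.
- move=> x /spanB[n [k [r [kB xk]]]].
  by exists n, (fun i => exist _ (k i) (kB i)), r.
Qed.

End UlmPositive.

(** * Comparing two modules *)

Section Compare.
Variables (R1 R2 : idomainType) (p1 : R1) (p2 : R2).
Variables (A1 : lmodType R1) (A2 : lmodType R2).
Local Notation F1 := (@ulm_filtration _ p1 A1).
Local Notation F2 := (@ulm_filtration _ p2 A2).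
Hypotheses (pP1 : uniformizer p1) (pP2 : uniformizer p2).
Hypotheses (red1 : reduced A1) (red2 : reduced A2).

(** [x] and [y] have the same Ulm sequence, in terms of the filtrations. *)
Definition same_heights (x : A1) (y : A2) : Prop :=
  forall i a, F1 a (p1 ^+ i *: x) <-> F2 a (p2 ^+ i *: y).

Lemma height_eqP (x : A1) (y : A2) :
  height p1 x = height p2 y <-> forall a, F1 a x <-> F2 a y.
Proof.
have h0 (R : idomainType) (p : R) (A : lmodType R) : height p (0 : A) = None.
  by rewrite /height eqxx.
have [->|x0] := pselect (x = 0); have [->|y0] := pselect (y = 0).
- rewrite !h0; split=> // _ a; split=> _; exact: filtration_mem0.
- have [a ay nay] := height_ex pP2 red2 y0; rewrite h0 (height_eq ay nay).
  split=> // /(_ (ord_succ a))[+ _] => H; case: nay; apply: H.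
  exact: filtration_mem0.
- have [a ax nax] := height_ex pP1 red1 x0; rewrite h0 (height_eq ax nax).
  split=> // /(_ (ord_succ a))[_ +] => H; case: nax; apply: H.
  exact: filtration_mem0.
have [a ax nax] := height_ex pP1 red1 x0; rewrite (height_eq ax nax).
split=> [|xy].
  have [b yb nyb] := height_ex pP2 red2 y0; rewrite (height_eq yb nyb) => -[ab] c.
  by rewrite -ab in yb nyb; rewrite (filtration_height ax nax) (filtration_height yb nyb).
by rewrite (@height_eq _ _ _ y a) // -xy.
Qed.

Lemma ulm_sequence_eqP (x : A1) (y : A2) :
  ulm_sequence p1 x = ulm_sequence p2 y <-> same_heights x y.
Proof.
split=> [E i|xy]; first by apply/height_eqP; apply: (congr1 (fun h => h i) E).
by apply/funext => i; apply/height_eqP/xy.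
Qed.

(** Every Ulm sequence occurring in [A1] occurs in [A2]: a preimage under [p2] of
    the element realizing the tail has the right height, after the addition of a
    socle element of that height when the sequence has a gap there. *)
Lemma same_heights_ex : torsion A1 ->
  (forall a, has_socle_height p1 A1 a -> has_socle_height p2 A2 a) ->
  forall x : A1, exists y : A2, same_heights x y.
Proof.
move=> tors1 pos x; have [n] := torsion_power pP1 tors1 x.
have same0 : same_heights 0 0.
  by move=> i a; rewrite !scaler0; split=> _; exact: filtration_mem0.
elim: n x => [|n IH] x; first by rewrite expr0 scale1r => ->; exists 0.
rewrite exprSr -scalerA => /IH[z xz].
have [->|x0] := pselect (x = 0); first by exists 0.
have [a ax nax] := height_ex pP1 red1 x0.
have F1px_F2z b : F1 b (p1 *: x) <-> F2 b z.
  by have := xz 0%N b; rewrite !expr0 !scale1r.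
suff [y [ay nay yz]] : exists y, [/\ F2 a y, ~ F2 (ord_succ a) y & p2 *: y = z].
  exists y => -[|i] b; last by rewrite !exprSr -!scalerA yz; apply: xz.
  by rewrite !expr0 !scale1r (filtration_height ax nax) (filtration_height ay nay).
have [apx|napx] := pselect (F1 (ord_succ (ord_succ a)) (p1 *: x)).
  have [v [av _ uS]] := height_gap ax apx.
  have [|u [pu au] nau] := pos a.
    exists (x - v) => // ax'; apply: nax; rewrite -(subrK v x).
    by apply: submoduleD => //; apply: ulm_filtration_submodule.
  have /F1px_F2z := apx; rewrite ulm_filtrationS => -[w aw <-].
  exists (u + w); split.
  - apply: submoduleD => //; first exact: ulm_filtration_submodule.
    exact: filtrationSS.
  - move=> auw; apply: nau; rewrite -(addrK w u); apply: submoduleB => //.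
    exact: ulm_filtration_submodule.
  - by rewrite scalerDr pu add0r.
have /F1px_F2z := filtration_scale ax; rewrite {1}ulm_filtrationS => -[y ay yz].
exists y; split=> // /filtration_scale; rewrite yz => az.
by apply: napx; apply/F1px_F2z.
Qed.

End Compare.

Lemma same_heights_sym (R1 R2 : idomainType) (p1 : R1) (p2 : R2)
    (A1 : lmodType R1) (A2 : lmodType R2) (x : A1) (y : A2) :
  same_heights p1 p2 x y -> same_heights p2 p1 y x.
Proof. by move=> xy i a; apply: iff_sym. Qed.

Lemma same_heights_trans (R1 R2 R3 : idomainType) (p1 : R1) (p2 : R2) (p3 : R3)
    (A1 : lmodType R1) (A2 : lmodType R2) (A3 : lmodType R3)
    (x : A1) (y : A2) (z : A3) :
  same_heights p1 p2 x y -> same_heights p2 p3 y z -> same_heights p1 p3 x z.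
Proof. by move=> xy yz i a; apply: iff_trans (xy i a) (yz i a). Qed.

(** * The isomorphism of orbit posets *)

Theorem theorem17 (R1 R2 : idomainType) (p1 : R1) (p2 : R2)
    (A1 : lmodType R1) (A2 : lmodType R2)
    (dvr1 : is_dvr R1) (dvr2 : is_dvr R2)
    (p1_max : maximal_ideal (principal_ideal p1))
    (p2_max : maximal_ideal (principal_ideal p2))
    (tors1 : torsion A1) (tors2 : torsion A2)
    (red1 : reduced A1) (red2 : reduced A2)
    (cg1 : countably_generated A1) (cg2 : countably_generated A2)
    (ulm_pos : forall a : ord,
       ulm_invariant_positive p1 A1 a <-> ulm_invariant_positive p2 A2 a) :
  exists F : orbits A1 -> orbits A2,
    [/\ bijective F,
        forall O O' : orbits A1, orbit_le O O' <-> orbit_le (F O) (F O') &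
        forall (a1 : A1) (a2 : A2),
          F (to_orbits a1) = to_orbits a2 <->
          ulm_sequence p1 a1 = ulm_sequence p2 a2].
Proof.
have pP1 := dvr_uniformizer dvr1 p1_max; have pP2 := dvr_uniformizer dvr2 p2_max.
have pos a : has_socle_height p1 A1 a <-> has_socle_height p2 A2 a.
  by rewrite -!ulm_invariant_positiveP.
have ex12 (x : A1) : {y : A2 | same_heights p1 p2 x y}.
  by apply: cid; apply: (same_heights_ex pP1 red1 tors1) => a /pos.
have ex21 (y : A2) : {x : A1 | same_heights p2 p1 y x}.
  by apply: cid; apply: (same_heights_ex pP2 red2 tors2) => a /pos.
pose F (O : orbits A1) := to_orbits (sval (ex12 (sval (cid (svalP O))))).
pose F' (O : orbits A2) := to_orbits (sval (ex21 (sval (cid (svalP O))))).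
have orbits_repr (R : idomainType) (A : lmodType R) (O : orbits A) :
    O = to_orbits (sval (cid (svalP O))).
  by case: (cid (svalP O)) => x; case: O => C HC /= E; apply: eq_exist.
have orb1 := to_orbitsP pP1 tors1 red1 cg1; have orb2 := to_orbitsP pP2 tors2 red2 cg2.
have FP x y : F (to_orbits x) = to_orbits y <-> same_heights p1 p2 x y.
  rewrite /F; set x' := sval (cid _); case: (ex12 x') => y' x'y' /=.
  have xx' : same_heights p1 p1 x x' by apply/orb1; apply: orbits_repr.
  split=> [/orb2 y'y|xy].
    exact: same_heights_trans xx' (same_heights_trans x'y' y'y).
  apply/orb2; apply: same_heights_trans (same_heights_sym x'y') _.
  exact: same_heights_trans (same_heights_sym xx') xy.
have F'P y x : F' (to_orbits y) = to_orbits x <-> same_heights p2 p1 y x.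
  rewrite /F'; set y' := sval (cid _); case: (ex21 y') => x' y'x' /=.
  have yy' : same_heights p2 p2 y y' by apply/orb2; apply: orbits_repr.
  split=> [/orb1 x'x|yx].
    exact: same_heights_trans yy' (same_heights_trans y'x' x'x).
  apply/orb1; apply: same_heights_trans (same_heights_sym y'x') _.
  exact: same_heights_trans (same_heights_sym yy') yx.
exists F; split.
- exists F' => O; rewrite [O](orbits_repr _ _ O); move: (sval _) => x {O}.
    have [y xy] := ex12 x; rewrite ((FP x y).2 xy).
    exact/F'P/same_heights_sym.
  have [y xy] := ex21 x; rewrite ((F'P x y).2 xy).
  exact/FP/same_heights_sym.
- move=> O O'; rewrite [O](orbits_repr _ _ O) [O'](orbits_repr _ _ O').
  move: (sval _) (sval _) => x x' {O O'}.
  have [y xy] := ex12 x; have [y' xy'] := ex12 x'.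
  rewrite ((FP x y).2 xy) ((FP x' y').2 xy') !orbit_leE.
  rewrite (degeneratesP pP1) // (degeneratesP pP2) //.
  by split=> H i a /(xy i a)/H/(xy' i a).
- by move=> x y; rewrite FP (ulm_sequence_eqP pP1 pP2).
Qed.
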